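(* Let $k$ be an algebraically closed field of characteristic $p>0$ and let $n\ge1$. Let $\mathcal X\subset\mathbb P^{n+1}$ be an irreducible hypersurface of degree $d\ge3$ over $k$ such that $P=[1:0:\cdots:0]$ is an extendable wild Galois point for $\mathcal X$, let $m$ be the multiplicity of $\mathcal X$ at $P$, and let $G_{\pi_P}\subset\mathrm{PGL}(n+2,k)$ be the Galois group of the projection $\pi_P\colon\mathcal X\dashrightarrow\mathbb P^n$. Write $d-m=p^ul$ with $\gcd(p,l)=1$. Assume that there exists a group $G\subset\mathrm{UT}( *,I_{n+1})$ such that the homomorphism $pr|_G\colon G\to G_{\pi_P}$ is an isomorphism and $$G=\left\langle\begin{pmatrix}e_l&0\\0&I_{n+1}\end{pmatrix},\ G_p\right\rangle,$$ where $G_p$ is a Sylow $p$-subgroup of $G$ and $e_l\in k$ is a primitive $l$-th root of unity. Let $F(X_0,\ldots,X_{n+1})$ be the defining polynomial of $\mathcal X$. Then there exist $A(X_1,\ldots,X_{n+1})\in k[X_1,\ldots,X_{n+1}]_m$ and $B(X_1,\ldots,X_{n+1})\in k[X_1,\ldots,X_{n+1}]_d$ such that $$F(X_0,\ldots,X_{n+1})=A(X_1,\ldots,X_{n+1})\left(\prod_{g\in G}g^*X_0\right)+B(X_1,\ldots,X_{n+1}).$$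
   Context: $pr\colon\mathrm{GL}(n+2,k)\to\mathrm{PGL}(n+2,k)$, $A\mapsto[A]$, is the natural projection. $k[Y_1,\ldots,Y_r]_s$ is the $k$-vector space of forms of degree $s$. $\mathrm{UT}( *,I_{n+1})$ is the subgroup of $\mathrm{GL}(n+2,k)$ of matrices $\begin{pmatrix}a&\overline b\\0&I_{n+1}\end{pmatrix}$ with $a\in k^\times$, $\overline b\in k^{n+1}$ (a row vector). For $g=(a_{ij})\in\mathrm{GL}(n+2,k)$ and a form $F$, $g^*F(X_0,\ldots,X_{n+1}):=F\left(\sum_{i=1}^{n+2}a_{1i}X_{i-1},\ldots,\sum_{i=1}^{n+2}a_{n+2\,i}X_{i-1}\right)$; in particular $g^*X_0=\sum_{i=1}^{n+2}a_{1i}X_{i-1}$. The projection $\pi_P$ with center $P$ is $[X_0:\cdots:X_{n+1}]\mapsto[X_1:\cdots:X_{n+1}]$; it is assumed dominant ($m<d$) and induces a field extension $k(\mathbb P^n)\hookrightarrow k(\mathcal X)$ of degree $d-m$. $P$ is a Galois point for $\mathcal X$ if this extension is Galois, and wild if moreover $p\mid d-m$. The Galois group is $G_{\pi_P}=\{g\in\mathrm{Bir}(\mathcal X)\mid\pi_P\circ g=\pi_P\}$ (automorphisms of $k(\mathcal X)$ are identified with birational self-maps via pullback). $P$ is extendable if every element of $G_{\pi_P}$ is the restriction to $\mathcal X$ of an element of $\mathrm{PGL}(n+2,k)$ preserving $\mathcal X$, and then $G_{\pi_P}$ is regarded as a subgroup of $\mathrm{PGL}(n+2,k)$. By convention $e_1=1$.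 *)

(* Defs.v *)
From HB Require Import structures.
From mathcomp Require Import all_boot all_order all_algebra all_fingroup all_solvable all_field all_character.
From mathcomp Require Import generic_quotient ring_quotient fraction.
From mathcomp Require Import boolp mpoly.

Set Implicit Arguments.
Unset Strict Implicit.
Unset Printing Implicit Defensive.

Import GRing.Theory.

Local Open Scope ring_scope.

Definition irreducible_elt (R : unitRingType) (a : R) : Prop :=
  [/\ a != 0, a \isn't a GRing.unit &
      forall b c : R, a = b * c -> b \is a GRing.unit \/ c \is a GRing.unit].

Definition divides (R : nzRingType) (a b : R) : Prop := exists c, b = c * a.

Definition prime_elt (R : nzRingType) (a : R) : Prop :=
  forall b c : R, divides a (b * c) -> divides a b \/ divides a c.

(* Irreducible multivariate polynomials over a field are prime (Gauss), so that
   homogeneous coordinate rings of irreducible hypersurfaces are domains. *)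
Section GaussLemma.

Variables (R : idomainType) (N : R -> nat).
Hypothesis NM : forall a b : R, a != 0 -> b != 0 -> N (a * b) = (N a + N b)%N.
Hypothesis NU : forall a : R, a != 0 -> N a = 0 -> a \is a GRing.unit.
Hypothesis irr_prime : forall c : R, irreducible_elt c -> prime_elt c.

Let primitive (F : {poly R}) : Prop :=
  forall c : R, irreducible_elt c -> ~ divides c%:P F.

Let reducible_split (c : R) : c != 0 -> c \isn't a GRing.unit ->
  ~ irreducible_elt c ->
  exists c1 c2, [/\ c = c1 * c2, c1 != 0, c2 != 0, (N c1 < N c)%N & (N c2 < N c)%N].
Proof.
move=> c0 cU cI.
have [c1 [c2 [ec u1 u2]]] : exists c1 c2,
    [/\ c = c1 * c2, c1 \isn't a GRing.unit & c2 \isn't a GRing.unit].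
  apply: contrapT => H; apply: cI; split=> // b d ebd.
  case: (boolP (b \is a GRing.unit)) => ub; first by left.
  case: (boolP (d \is a GRing.unit)) => ud; first by right.
  by case: H; exists b, d.
exists c1, c2.
have : c1 * c2 != 0 by rewrite -ec.
rewrite mulf_eq0 negb_or => /andP[z1 z2].
have P a : a != 0 -> a \isn't a GRing.unit -> (0 < N a)%N.
  by move=> a0; rewrite lt0n; apply: contraNneq => /(NU a0).
have := P _ z1 u1; have := P _ z2 u2; rewrite ec NM // => p2 p1.
by split=> //; [rewrite -{1}[N c1]addn0 ltn_add2l|rewrite -{1}[N c2]add0n ltn_add2r].
Qed.

Let const_prime (c : R) : irreducible_elt c -> prime_elt c%:P.
Proof.
move=> /irr_prime cP a b.
have [m] := ubnP (size a + size b); elim: m => // m IH in a b * => lt_m dv.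
have [->|a0] := eqVneq a 0; first by left; exists 0; rewrite mul0r.
have [->|b0] := eqVneq b 0; first by right; exists 0; rewrite mul0r.
have : divides c (lead_coef a * lead_coef b).
  case: dv => q; rewrite -lead_coefM => ->.
  by exists (lead_coef q); rewrite lead_coefM lead_coefC.
have step (x y : {poly R}) : x != 0 -> (size x + size y < m.+1)%N ->
    divides c%:P (x * y) -> divides c (lead_coef x) ->
    divides c%:P x \/ divides c%:P y.
  move=> x0 lt_xy [q eq] [r er].
  have [T [M [sT exx]]] : exists T M : {poly R},
      (size T < size x)%N /\ x = T + M * c%:P.
    exists (take_poly (size x).-1 x), (r%:P * 'X^((size x).-1)); split.
      by rewrite (leq_ltn_trans (size_take_poly _ _)) // prednK // size_poly_gt0.
    rewrite -{1}(poly_take_drop (size x).-1 x); congr (_ + _).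
    have -> : drop_poly (size x).-1 x = (lead_coef x)%:P.
      apply/polyP => i; rewrite coef_drop_poly coefC /lead_coef.
      case: i => [|i] /=; first by rewrite add0n.
      by rewrite nth_default // addSnnS prednK ?leq_addl // size_poly_gt0.
    by rewrite er polyCM -mulrA [c%:P * _]mulrC mulrA.
  have [||[s es]|] := IH T y.
  - by rewrite -ltnS; apply: leq_trans lt_xy; rewrite ltnS ltn_add2r.
  - by exists (q - M * y); rewrite mulrBl -eq exx mulrDl [M * y * _]mulrAC addrK.
  - by left; exists (s + M); rewrite mulrDl -es -exx.
  - by right.
case/cP => dc; first exact: step.
rewrite mulrC in dv; rewrite addnC in lt_m.
by case: (step b a b0 lt_m dv dc); [right|left].
Qed.

Let primitive_cancel (F a q : {poly R}) (c : R) :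
  c != 0 -> primitive F -> a * c%:P = q * F -> divides F a.
Proof.
move=> c0 Fp; have [m] := ubnP (N c); elim: m => // m IH in c c0 a q * => lt_m e.
have [cU|cU] := boolP (c \is a GRing.unit).
  exists (q * (c^-1)%:P).
  by rewrite mulrAC -e -mulrA -polyCM mulrV // mulr1.
have [cI|cI] := EM (irreducible_elt c).
  have [|[s es]|/(Fp _ cI)//] := @const_prime c cI q F.
    by exists a.
  exists s; apply: (mulIf (x := c%:P)); first by rewrite polyC_eq0.
  by rewrite e es mulrAC.
have [c1 [c2 [ec z1 z2 l1 l2]]] := reducible_split c0 cU cI.
have [q' e'] : divides F (a * c1%:P).
  apply: (IH c2 z2 _ q); first exact: leq_trans l2 _.
  by rewrite -mulrA -polyCM -ec.
by apply: (IH c1 z1 _ q') => //; exact: leq_trans l1 _.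
Qed.

Let primitive_part (g : {poly R}) : g != 0 ->
  exists c g', [/\ c != 0, g = g' * c%:P & primitive g'].
Proof.
have [m] := ubnP (N (lead_coef g)); elim: m => // m IH in g * => lt_m g0.
have [gp|] := EM (primitive g).
  by exists 1, g; rewrite mulr1 oner_eq0.
move=> /existsNP[c] /not_implyP[cI] /contrapT[g1 eg].
have c0 : c != 0 by case: cI.
have g10 : g1 != 0 by apply: contraNneq g0 => z; rewrite eg z mul0r.
have [||c' [g' [z' e' p']]] := IH g1 => //.
  have := lt_m; rewrite eg lead_coefM lead_coefC NM ?lead_coef_eq0 //.
  rewrite ltnS; apply: leq_trans; rewrite -addn1 leq_add2l lt0n.
  by apply: contraPneq cI => /(NU c0) cU []; rewrite cU.
by exists (c' * c), g'; rewrite mulf_neq0 // polyCM mulrA -e'.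
Qed.

Lemma poly_irreducible_prime (F : {poly R}) : irreducible_elt F -> prime_elt F.
Proof.
move=> FI; have [F0 FU Ff] := FI.
have [sF|sF] := eqVneq (size F) 1%N.
  have eF : F = (F`_0)%:P by apply: size1_polyC; rewrite sF.
  rewrite eF; apply: const_prime; split.
  - by rewrite -polyC_eq0 -eF.
  - by apply: contraNN FU => U; rewrite poly_unitE sF eqxx.
  move=> b c e; case: (Ff b%:P c%:P); first by rewrite eF e polyCM.
    by rewrite poly_unitE coefC => /andP[_]; left.
  by rewrite poly_unitE coefC => /andP[_]; right.
have Fp : primitive F.
  move=> c [c0 cU _] [q eq]; case: (Ff _ _ eq).
    rewrite poly_unitE => /andP[/eqP sq _]; case/eqP: sF.
    by rewrite eq mulrC mul_polyC size_scale.
  by rewrite poly_unitE coefC => /andP[_]; apply/negP.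
have dvF x : Pdiv.Idomain.dvdp F x -> divides F x.
  case/Pdiv.Idomain.dvdpP => -[c q] /= c0 e.
  by apply: (primitive_cancel (c := c) (q := q)) => //; rewrite mulrC mul_polyC.
move=> a b [r er].
have := Pdiv.CommonIdomain.dvdp_gcdl F a; set g := gcdp F a => dgF.
have g0 : g != 0 by rewrite gcdp_eq0 negb_and F0.
have [c [g' [c0 eg gp]]] := primitive_part g0.
have [q eq] : divides g' F.
  case/Pdiv.Idomain.dvdpP: dgF => -[c1 q] /= c10 e.
  apply: (primitive_cancel (c := c1) (q := q * c%:P)) => //.
  by rewrite mulrC mul_polyC e eg mulrAC mulrA.
have sg : size g = size g' by rewrite eg mulrC mul_polyC size_scale.
case: (Ff _ _ eq); rewrite poly_unitE => /andP[/eqP s1 _].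
  have q0 : q != 0 by rewrite -size_poly_gt0 s1.
  have g'0 : g' != 0 by rewrite -size_poly_gt0 -sg size_poly_gt0.
  left; apply: dvF.
  have /eqp_dvdl <- : g %= F.
    rewrite -Pdiv.Idomain.dvdp_size_eqp // sg eq size_mul // s1 add1n.
    by rewrite eqxx.
  exact: Pdiv.CommonIdomain.dvdp_gcdr.
right; apply: dvF.
have co : coprimep F a by rewrite /coprimep -/g sg s1.
rewrite -(Pdiv.Idomain.Gauss_dvdpr _ co).
by apply/Pdiv.Idomain.dvdpP; exists (1, r); rewrite ?oner_eq0 //= scale1r.
Qed.

End GaussLemma.

Lemma mpoly_ext (R : nzRingType) n (V : zmodType) (f g : {mpoly R[n]} -> V) :
  f 0 = g 0 -> {morph f : x y / x + y} -> {morph g : x y / x + y} ->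
  (forall c m, f (c *: 'X_[m]) = g (c *: 'X_[m])) -> f =1 g.
Proof.
move=> e0 fD gD e; elim/mpolyind => [//|c m p _ _ IH].
by rewrite fD gD e IH.
Qed.

Lemma poly_ext (R : nzRingType) (V : zmodType) (f g : {poly R} -> V) :
  f 0 = g 0 -> {morph f : x y / x + y} -> {morph g : x y / x + y} ->
  (forall c, f c%:P = g c%:P) ->
  (forall p, f p = g p -> f (p * 'X) = g (p * 'X)) -> f =1 g.
Proof.
move=> e0 fD gD eC eX; elim/poly_ind => [//|p c IH].
by rewrite fD gD eC eX.
Qed.

Section MPolyPrime.

Variable k : fieldType.

Let back n : {poly {mpoly k[n]}} -> {mpoly k[n.+1]} :=
  fun p => (map_poly (@mwiden n k) p).['X_ord_max].

Let backM n : {morph @back n : p q / p * q}.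
Proof. by move=> p q; rewrite /back rmorphM hornerM. Qed.

Let backD n : {morph @back n : p q / p + q}.
Proof. by move=> p q; rewrite /back rmorphD hornerD. Qed.

Let muniX n (m : 'X_{1..n.+1}) : muni 'X_[k, m] =
  'X_[[multinom (m (widen_ord (leqnSn n) i)) | i < n]] *: 'X^(m ord_max).
Proof. by rewrite muniE msuppX big_seq1 mcoeffX eqxx scale1r. Qed.

Let back0 n : @back n 0 = 0.
Proof. by rewrite /back rmorph0 horner0. Qed.

Let muniK n : cancel (@muni n k) (@back n).
Proof.
apply: (mpoly_ext (f := fun p => back (muni p)) (g := id)) => //.
- by rewrite muni0 back0.
- by move=> p q; rewrite muniD backD.
move=> c m; rewrite muniZ -mul_polyC backM muniX /back map_polyC hornerC /= mwidenC.
rewrite map_polyZ map_polyXn hornerZ hornerXn /= mwidenX mpolyXn -mpolyXD.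
suff -> : (mnmwiden [multinom m (widen_ord (leqnSn n) i) | i < n] +
            U_(ord_max) *+ m ord_max = m)%MM by rewrite mul_mpolyC.
apply/mnmP => i; rewrite mnmDE mulmnE.
have [j ej|ei] := unliftP ord_max i; last first.
  by rewrite ei mnmwiden_ordmax mnm1E eqxx mul1n.
have -> : i = widen_ord (leqnSn n) j.
  by apply/val_inj; rewrite ej /= /bump leqNgt ltn_ord.
rewrite mnmwiden_widen mnmE mnm1E.
by rewrite -val_eqE /= gtn_eqF // mul0n addn0.
Qed.

Let muni_mwiden n (q : {mpoly k[n]}) : muni (mwiden q) = q%:P.
Proof.
apply: (mpoly_ext (f := fun p => muni (mwiden p)) (g := polyC)) => //.
- by rewrite mwiden0 muni0.
- by move=> p r; rewrite mwidenD muniD.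
- by move=> p r; rewrite polyCD.
move=> c m; rewrite mwidenZ mwidenX muniZ muniX mnmwiden_ordmax expr0.
rewrite -!mul_polyC mulr1 -polyCM -mul_mpolyC.
suff -> : [multinom mnmwiden m (widen_ord (leqnSn n) i) | i < n] = m by [].
by apply/mnmP => i; rewrite mnmE mnmwiden_widen.
Qed.

Let muni_Xmax n : muni 'X_ord_max = 'X :> {poly {mpoly k[n]}}.
Proof.
rewrite muniX mnm1E eqxx expr1 (_ : [multinom _ | i < n] = 0%MM).
  by rewrite mpolyX0 scale1r.
by apply/mnmP => i; rewrite mnmE mnm1E mnm0E -val_eqE /= gtn_eqF.
Qed.

Let backK n : cancel (@back n) (@muni n k).
Proof.
apply: (poly_ext (f := fun p => muni (back p)) (g := id)) => //.
- by rewrite back0 muni0.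
- by move=> p q; rewrite backD muniD.
- by move=> c; rewrite /back map_polyC hornerC /= muni_mwiden.
move=> p e; rewrite backM muniM {}e; congr (_ * _).
by rewrite /back map_polyX hornerX muni_Xmax.
Qed.

Lemma mpoly_irreducible_prime n (F : {mpoly k[n]}) :
  irreducible_elt F -> prime_elt F.
Proof.
elim: n => [|n IH] in F *.
  have eF : F = (F@_0)%:MP.
    apply/mpolyP => m; have -> : m = 0%MM by apply/mnmP => -[].
    by rewrite mcoeffC eqxx mulr1.
  case=> F0 /negP[]; rewrite eF rmorph_unit // unitfE.
  by apply: contraNneq F0 => z; rewrite eF z.
move=> [F0 FU Ff].
have muU (G : {mpoly k[n.+1]}) : (muni G \is a GRing.unit) = (G \is a GRing.unit).
  apply/idP/idP; last exact: rmorph_unit.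
  move=> /unitrP[h [h1 _]]; apply/unitrP; exists (back h).
  by split; [|rewrite mulrC]; rewrite -[X in _ * X = _]muniK -backM h1 /back rmorph1 hornerC.
have P : prime_elt (muni F).
  apply: (@poly_irreducible_prime _ (fun a => (msize a).-1)).
  - by move=> a b a0 b0; rewrite msizeM // (mpolySpred _ a0) (mpolySpred _ b0) addnS.
  - move=> a a0 Na.
    have ea : a = (a@_0)%:MP by apply: msize1_polyC; rewrite (mpolySpred _ a0) Na.
    rewrite ea rmorph_unit // unitfE; apply: contraNneq a0 => z.
    by rewrite ea z.
  - exact: IH.
  split; last first.
  - move=> b c e; have [|ub|uc] := Ff (back b) (back c).
    + by rewrite -backM -e muniK.
    + by left; rewrite -[b]backK muU.
    + by right; rewrite -[c]backK muU.
  - by rewrite muU.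
  - by apply: contraNneq F0 => z; rewrite -[F]muniK z /back rmorph0 horner0.
move=> a b [q e]; case: (P (muni a) (muni b)).
- by exists (muni q); rewrite -[LHS]muniM e muniM.
- move=> [r er]; left; exists (back r).
  by rewrite -[LHS]muniK er backM; congr (_ * _); exact: muniK.
- move=> [r er]; right; exists (back r).
  by rewrite -[LHS]muniK er backM; congr (_ * _); exact: muniK.
Qed.

End MPolyPrime.

(* An irreducible hypersurface of degree d in P^(n+1), given by its defining
   form; coordinates are numbered from 0, so 'X_ord0 is X_0. *)
Record hypersurface (k : fieldType) (n d : nat) := Hypersurface {
  defpoly :> {mpoly k[n.+2]};
  defpoly_homog : defpoly \is d.-homog;
  defpoly_irreducible : irreducible_elt defpoly
}.

Section CoordinateRing.

Variables (k : fieldType) (n d : nat) (X : hypersurface k n d).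

Definition hyp_ideal : {pred {mpoly k[n.+2]}} := fun G => `[< divides (defpoly X) G >].

Let hyp_idealP G : reflect (divides (defpoly X) G) (G \in hyp_ideal).
Proof. exact: asboolP. Qed.

Lemma hyp_ideal_closed : idealr_closed hyp_ideal.
Proof.
split.
- by apply/hyp_idealP; exists 0; rewrite mul0r.
- apply/hyp_idealP => -[q e]; have [_ /negP nU _] := defpoly_irreducible X.
  by apply: nU; apply/unitrP; exists q; rewrite [_ * q]mulrC -e.
- move=> a u v /hyp_idealP[q ->] /hyp_idealP[r ->]; apply/hyp_idealP.
  by exists (a * q + r); rewrite mulrDl mulrA.
Qed.

HB.instance Definition _ :=
  isIdealr.Build {mpoly k[n.+2]} hyp_ideal hyp_ideal_closed.

Lemma hyp_ideal_prime : prime_idealr_closed hyp_ideal.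
Proof.
move=> u v /hyp_idealP uv; apply/orP.
case: (mpoly_irreducible_prime (defpoly_irreducible X) uv) => H.
  by left; apply/hyp_idealP.
by right; apply/hyp_idealP.
Qed.

HB.instance Definition _ :=
  isPrimeIdealrClosed.Build {mpoly k[n.+2]} hyp_ideal hyp_ideal_prime.

Definition coord_ring := {ideal_quot hyp_ideal}.

HB.instance Definition _ := GRing.ComNzRing.on coord_ring.

Definition cr_unit : {pred coord_ring} := fun x => `[< exists y, y * x = 1 >].

Definition cr_inv (x : coord_ring) : coord_ring :=
  if pselect (exists y, y * x = 1) is left ex then projT1 (cid ex) else x.

Lemma cr_mulVx : {in cr_unit, left_inverse 1 cr_inv *%R}.
Proof.
move=> x /asboolP ux; rewrite /cr_inv.
by case: pselect => // ex; case: (cid ex).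
Qed.

Lemma cr_unitP (x y : coord_ring) : y * x = 1 -> x \in cr_unit.
Proof. by move=> e; apply/asboolP; exists y. Qed.

Lemma cr_inv_out : {in [predC cr_unit], cr_inv =1 id}.
Proof.
move=> x /negP ux; rewrite /cr_inv; case: pselect => // ex.
by case: ux; apply/asboolP.
Qed.

HB.instance Definition _ :=
  GRing.ComNzRing_hasMulInverse.Build coord_ring cr_mulVx cr_unitP cr_inv_out.

Lemma cr_idomain (x y : coord_ring) : x * y = 0 -> (x == 0) || (y == 0).
Proof. exact: (@Quotient.rquot_IdomainAxiom _ hyp_ideal). Qed.

HB.instance Definition _ :=
  GRing.ComUnitRing_isIntegral.Build coord_ring cr_idomain.

Definition coord_proj (G : {mpoly k[n.+2]}) : coord_ring :=
  \pi_({ideal_quot hyp_ideal})%qT G.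

Lemma coord_proj_zmod : zmod_morphism coord_proj.
Proof. by move=> x y; rewrite /coord_proj rmorphB. Qed.

Lemma coord_proj_monoid : monoid_morphism coord_proj.
Proof. by split=> [|x y]; rewrite /coord_proj ?rmorph1 ?rmorphM. Qed.

HB.instance Definition _ :=
  GRing.isZmodMorphism.Build {mpoly k[n.+2]} coord_ring coord_proj coord_proj_zmod.
HB.instance Definition _ :=
  GRing.isMonoidMorphism.Build {mpoly k[n.+2]} coord_ring coord_proj coord_proj_monoid.

End CoordinateRing.

(* For a homogeneous coordinate ring q : k[X_0..X_(N-1)] ->> R that is a domain,
   the function field of the projective variety: the subfield of Frac(R) of the
   quotients of two forms of the same degree. *)
Section ProjectiveFunctionField.

Local Notation "x %:F" := (tofrac x).

Variables (k : fieldType) (N : nat) (R : idomainType).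
Variable q : {rmorphism {mpoly k[N]} -> R}.

Definition homog_fraction : {pred {fraction R}} := fun x =>
  `[< exists e (a b : {mpoly k[N]}),
        [/\ a \is e.-homog, b \is e.-homog, q b != 0 &
            x = (q a)%:F / (q b)%:F] >].

Lemma homog_fraction_closed : divring_closed homog_fraction.
Proof.
split.
- apply/asboolP; exists 0, 1, 1; rewrite dhomog1 rmorph1 oner_neq0.
  by rewrite tofrac1 divr1.
- move=> x y /asboolP[e [a [b [ha hb b0 ->]]]] /asboolP[f [c [g [hc hg g0 ->]]]].
  apply/asboolP; exists (e + f)%N, (a * g - c * b), (b * g); split.
  + by rewrite rpredB //; [|rewrite addnC]; apply: dhomogM.
  + exact: dhomogM.
  + by rewrite rmorphM mulf_neq0.
  by rewrite -mulNr addf_div ?tofrac_eq0 // mulNr rmorphB !rmorphM rmorphB !rmorphM.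
- move=> x y /asboolP[e [a [b [ha hb b0 ->]]]] /asboolP[f [c [g [hc hg g0 ->]]]].
  apply/asboolP; have [c0|c0] := eqVneq (q c) 0.
    exists 0, 0, 1; rewrite dhomog0 dhomog1 rmorph1 oner_neq0 rmorph0.
    by rewrite c0 tofrac0 !mul0r invr0 mulr0.
  exists (e + f)%N, (a * g), (b * c); split; [exact: dhomogM|exact: dhomogM| |].
    by rewrite rmorphM mulf_neq0.
  by rewrite invf_div mulf_div !rmorphM.
Qed.

HB.instance Definition _ :=
  GRing.isDivringClosed.Build {fraction R} homog_fraction homog_fraction_closed.

Definition proj_field := {x : {fraction R} | x \in homog_fraction}.

HB.instance Definition _ := [isSub of proj_field for sval].
HB.instance Definition _ := [Choice of proj_field by <:].
HB.instance Definition _ := [SubChoice_isSubIntegralDomain of proj_field by <:].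

Lemma proj_field_fieldP : GRing.field_axiom proj_field.
Proof.
move=> x x0; apply/unitrP.
have vx0 : val x != 0 by rewrite (inj_eq val_inj x (0 : proj_field)).
have xV : (val x)^-1 \in homog_fraction by rewrite rpredV; exact: valP.
pose y : proj_field := exist _ (val x)^-1 xV.
have e : y * x = 1 by apply: val_inj; rewrite rmorphM rmorph1; exact: mulVf.
by exists y; rewrite [x * y]mulrC.
Qed.

HB.instance Definition _ :=
  GRing.UnitRing_isField.Build proj_field proj_field_fieldP.

(* The class of a / b, for forms a and b of the same degree with q b != 0;
   outside this case the value carries no meaning. *)
Definition homog_quot (a b : {mpoly k[N]}) : proj_field :=
  insubd 0 ((q a)%:F / (q b)%:F).

End ProjectiveFunctionField.
(* E / K is a finite Galois extension via i: transported to the library's notion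
   along an isomorphism of E with a finite normal extension L of K. *)
Definition galois_extension (K E : fieldType) (i : {rmorphism K -> E}) : Prop :=
  exists (L : splittingFieldType K) (f : {rmorphism L -> E}),
    [/\ bijective f, forall c : K, f c%:A = i c & galois 1%AS {:L}%AS].

Section Geometry.

Variables (k : fieldType) (n d : nat).

(* [X_0 : ... : X_(n+1)] |-> [X_1 : ... : X_(n+1)], the projection with center
   P = [1 : 0 : ... : 0]. *)
Definition piP : (n.+1).-tuple {mpoly k[n.+2]} :=
  [tuple 'X_(lift ord0 i) | i < n.+1].

Definition piP_pull (A : {mpoly k[n.+1]}) : {mpoly k[n.+2]} := A \mPo piP.

(* g^* X_i, i = 0, ..., n+1: the linear self-map x |-> g x on column vectors. *)
Definition linear_map (g : 'M[k]_n.+2) : (n.+2).-tuple {mpoly k[n.+2]} :=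
  [tuple \sum_(j < n.+2) g i j *: 'X_j | i < n.+2].

Definition pullback (g : 'M[k]_n.+2) (F : {mpoly k[n.+2]}) : {mpoly k[n.+2]} :=
  F \mPo linear_map g.

(* Equality of the classes of two matrices in PGL(n+2, k). *)
Definition same_PGL (g h : 'M[k]_n.+2) : Prop :=
  exists c : k, c != 0 /\ g = c *: h.

(* UT(star, I_(n+1)) *)
Definition in_UT (g : 'M[k]_n.+2) : Prop :=
  exists (a : k) (b : 'rV[k]_n.+1),
    a != 0 /\ g = block_mx (a%:M : 'M_1) b 0 (1%:M : 'M_n.+1).

Definition function_field_Pn : fieldType :=
  proj_field (idfun : {rmorphism {mpoly k[n.+1]} -> {mpoly k[n.+1]}}).

Variable X : hypersurface k n d.

Definition function_field : fieldType := proj_field (@coord_proj k n d X).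

(* The multiplicity of X at P is m (0 if P is not on X): the least degree of a
   monomial of the dehomogenization F(1, x_1, ..., x_(n+1)). *)
Definition multiplicity_at_P (m : nat) : Prop :=
  let f : {mpoly k[n.+1]} := X \mPo [tuple of 1 :: [tuple 'X_i | i < n.+1]] in
  (forall t, t \in msupp f -> (m <= mdeg t)%N) /\
  (exists2 t, t \in msupp f & mdeg t = m).

(* A rational map from X to P^(N-1) is given by N forms of the same degree, not
   all vanishing on X, up to proportionality modulo the ideal of X. *)
Definition represents_rational_map N (phi : N.-tuple {mpoly k[n.+2]}) : Prop :=
  (exists e, forall i, tnth phi i \is e.-homog) /\
  (exists i, tnth phi i \notin hyp_ideal X).

Definition same_rational_map N (phi psi : N.-tuple {mpoly k[n.+2]}) : Prop :=
  [/\ represents_rational_map phi, represents_rational_map psi &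
      forall i j, tnth phi i * tnth psi j - tnth phi j * tnth psi i
                    \in hyp_ideal X].

Definition comp_map N (psi : N.-tuple {mpoly k[n.+2]})
    (phi : (n.+2).-tuple {mpoly k[n.+2]}) : N.-tuple {mpoly k[n.+2]} :=
  [tuple tnth psi i \mPo phi | i < N].

Definition id_map : (n.+2).-tuple {mpoly k[n.+2]} := [tuple 'X_i | i < n.+2].

Definition rational_self_map (phi : (n.+2).-tuple {mpoly k[n.+2]}) : Prop :=
  represents_rational_map phi /\ X \mPo phi \in hyp_ideal X.

Definition in_Bir (phi : (n.+2).-tuple {mpoly k[n.+2]}) : Prop :=
  rational_self_map phi /\
  exists psi, [/\ rational_self_map psi,
                  same_rational_map (comp_map psi phi) id_map &
                  same_rational_map (comp_map phi psi) id_map].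

(* {g in Bir(X) | pi_P o g = pi_P} *)
Definition in_galois_group (phi : (n.+2).-tuple {mpoly k[n.+2]}) : Prop :=
  in_Bir phi /\ same_rational_map (comp_map piP phi) piP.

Definition preserves (g : 'M[k]_n.+2) : Prop :=
  exists c : k, c != 0 /\ pullback g X = c *: defpoly X.

(* P is an extendable point: every element of the group above is the restriction
   to X of an element of PGL(n+2, k) preserving X. *)
Definition extendable : Prop :=
  forall phi, in_galois_group phi ->
    exists g : 'M[k]_n.+2,
      [/\ g \in unitmx, preserves g & same_rational_map phi (linear_map g)].

(* G_(pi_P) as a subgroup of PGL(n+2, k), given by its preimage in GL(n+2, k). *)
Definition in_galois_PGL (g : 'M[k]_n.+2) : Prop :=
  [/\ g \in unitmx, preserves g & in_galois_group (linear_map g)].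

(* i : k(P^n) -> k(X) is the pullback of rational functions along pi_P. Such an i
   exists only if pi_P restricted to X is dominant. *)
Definition is_piP_pullback (i : function_field_Pn -> function_field) : Prop :=
  forall e (a b : {mpoly k[n.+1]}), a \is e.-homog -> b \is e.-homog -> b != 0 ->
    i (homog_quot idfun a b) =
    homog_quot (@coord_proj k n d X) (piP_pull a) (piP_pull b).

Definition galois_point : Prop :=
  exists2 i : {rmorphism function_field_Pn -> function_field},
    is_piP_pullback i & galois_extension i.

Definition wild_galois_point (p m : nat) : Prop :=
  galois_point /\ (p %| d - m)%N.

End Geometry.

(* Main.v *)
Require Import Defs.
From HB Require Import structures.
From mathcomp Require Import all_boot all_order all_algebra all_fingroup all_solvable all_field all_character.
From mathcomp Require Import generic_quotient ring_quotient fraction boolp mpoly.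

Set Implicit Arguments.
Unset Strict Implicit.
Unset Printing Implicit Defensive.

Import GRing.Theory.

Local Open Scope ring_scope.

(* Write F as a polynomial f in X_0 over k[X_1, ..., X_(n+1)]; its degree is
   d - m. An element of G acts on f by X_0 |-> a X_0 + b(X_1, ..., X_(n+1)), and
   it multiplies f by the scalar a^(d-m). The corner a is a character of G that
   is trivial on the p-group Gp and equal to e_l on the other generator, so that
   a^l = 1 and f is invariant. Hence f(Y) - f(T) vanishes at the |G| distinct
   points Y = a T + b. Since the point P is Galois and extendable, the conjugates
   of X_0/X_1 over k(P^n) are among the a X_0/X_1 + b, which gives |G| >= d - m.
   So f(Y) - f(T) = A * prod (Y - (a T + b)) with A independent of Y and T, and
   Y = 0 gives the claim. *)

(** * The variable X_0 *)

Section MpolyMorphisms.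

Variables (R S : comNzRingType) (N : nat).

Lemma mpoly_morphE (f : {rmorphism {mpoly R[N]} -> S}) (G : {mpoly R[N]}) :
  f G = mmap (f \o @mpolyC N R) (fun i => f 'X_i) G.
Proof.
rewrite {1}[G]mpolyE rmorph_sum; apply: eq_bigr => t _.
rewrite -mul_mpolyC rmorphM mpolyXE_id rmorph_prod; congr (_ * _).
by apply: eq_bigr => i _; rewrite rmorphXn.
Qed.

Lemma mmap_ext (f g : R -> S) (u v : 'I_N -> S) (G : {mpoly R[N]}) :
  f =1 g -> u =1 v -> mmap f u G = mmap g v G.
Proof.
move=> efg euv; apply: eq_bigr => t _; rewrite efg; congr (_ * _).
by apply: eq_bigr => i _; rewrite euv.
Qed.

Lemma mpoly_morph_ext (f g : {rmorphism {mpoly R[N]} -> S}) :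
  (forall c, f c%:MP = g c%:MP) -> (forall i, f 'X_i = g 'X_i) -> f =1 g.
Proof.
by move=> eC eX G; rewrite (mpoly_morphE f) (mpoly_morphE g); apply: mmap_ext.
Qed.

(** Every monomial of [G] has degree [e] and so releases exactly [e] factors [c]. With [c] a common
    denominator, this is how forms are compared with their dehomogenizations. *)
Lemma mmap_homog_scale (f : R -> S) (c : S) (v : 'I_N -> S) e (G : {mpoly R[N]}) :
  G \is e.-homog -> mmap f (fun i => c * v i) G = c ^+ e * mmap f v G.
Proof.
move=> hG; rewrite /mmap mulr_sumr; apply: eq_big_seq => t /(dhomog_mf hG) <-.
rewrite mulrCA; congr (_ * _); rewrite /mmap1.
under eq_bigr do rewrite exprMn.
rewrite big_split /=; congr (_ * _).
by rewrite prodrXr mdegE.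
Qed.

End MpolyMorphisms.

Lemma rmorph_mmap (R S T : comNzRingType) N 
    (s : {rmorphism S -> T}) (f : R -> S) (v : 'I_N -> S) (G : {mpoly R[N]}) :
  s (mmap f v G) = mmap (s \o f) (fun i => s (v i)) G.
Proof.
rewrite /mmap rmorph_sum; apply: eq_bigr => t _; rewrite rmorphM; congr (_ * _).
by rewrite rmorph_prod; apply: eq_bigr => i _; rewrite rmorphXn.
Qed.

Lemma morph_comp_mpoly (R S : comNzRingType) M N
    (f : {rmorphism {mpoly R[N]} -> S}) (G : {mpoly R[M]})
    (phi : M.-tuple {mpoly R[N]}) :
  f (G \mPo phi) = mmap (f \o @mpolyC N R) (fun i => f (tnth phi i)) G.
Proof. exact: rmorph_mmap. Qed.

Lemma dhomog_comp_mpoly (R : comNzRingType) M N (G : {mpoly R[M]})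
    (phi : M.-tuple {mpoly R[N]}) u v :
  G \is u.-homog -> (forall i, tnth phi i \is v.-homog) ->
  G \mPo phi \is (v * u).-homog.
Proof.
move=> hG hphi; rewrite comp_mpolyEX big_seq; apply: rpred_sum => t /(dhomog_mf hG) <-.
apply: dhomogZ; rewrite comp_mpolyX [X in (v * X)%N]mdegE big_distrr /=.
elim/big_rec2: _ => [|i e P _ hP]; first exact: dhomog1.
by apply: dhomogM => //; apply: dhomogMn.
Qed.

Section FirstVariable.

Variables (k : fieldType) (n : nat).
Local Notation R0 := {mpoly k[n.+1]}.

(* The variable 'X_i of the coefficient ring is X_(i+1). *)
Definition poly_X0 : {mpoly k[n.+2]} -> {poly R0} :=
  mmap (polyC \o @mpolyC n.+1 k)
       (fun i => if unlift ord0 i is Some j then ('X_j)%:P else 'X).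

HB.instance Definition _ := GRing.RMorphism.on poly_X0.

Lemma poly_X0C c : poly_X0 c%:MP = c%:MP%:P.
Proof. by rewrite /poly_X0 mmapC. Qed.

Lemma poly_X0_X0 : poly_X0 'X_ord0 = 'X.
Proof. by rewrite /poly_X0 mmapX mmap1U unlift_none. Qed.

Lemma poly_X0_lift j : poly_X0 'X_(lift ord0 j) = ('X_j)%:P.
Proof. by rewrite /poly_X0 mmapX mmap1U liftK. Qed.

HB.instance Definition _ := GRing.RMorphism.copy (@piP_pull k n)
  (fun A : R0 => A \mPo Defs.piP k n).

Lemma piP_pullC c : @piP_pull k n c%:MP = c%:MP.
Proof. exact: comp_mpolyC. Qed.

Lemma piP_pullX i : @piP_pull k n 'X_i = 'X_(lift ord0 i).
Proof. by rewrite /piP_pull comp_mpolyXU -tnth_nth tnth_mktuple. Qed.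

Lemma dhomog_piP_pull e (A : R0) : A \is e.-homog -> piP_pull A \is e.-homog.
Proof.
move=> hA; rewrite -[e]mul1n; apply: dhomog_comp_mpoly => // i.
by rewrite tnth_mktuple dhomogX; apply/eqP/mdeg1.
Qed.

Lemma poly_X0_pull (A : R0) : poly_X0 (piP_pull A) = A%:P.
Proof.
have := @mpoly_morph_ext _ _ _ (poly_X0 \o @piP_pull k n) polyC; apply.
- by move=> c; rewrite /= piP_pullC poly_X0C.
- by move=> i; rewrite /= piP_pullX poly_X0_lift.
Qed.

Definition mpoly_of_X0 (p : {poly R0}) : {mpoly k[n.+2]} :=
  (map_poly (@piP_pull k n) p).['X_ord0].

HB.instance Definition _ := GRing.RMorphism.copy mpoly_of_X0
  (horner_eval 'X_ord0 \o map_poly (@piP_pull k n)).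

Lemma poly_X0K : cancel poly_X0 mpoly_of_X0.
Proof.
have := @mpoly_morph_ext _ _ _ (mpoly_of_X0 \o poly_X0) idfun; apply => /= [c|i].
  by rewrite poly_X0C /mpoly_of_X0 map_polyC hornerC /= piP_pullC.
case: (unliftP ord0 i) => [j|] ->.
  by rewrite poly_X0_lift /mpoly_of_X0 map_polyC hornerC /= piP_pullX.
by rewrite poly_X0_X0 /mpoly_of_X0 map_polyX hornerX.
Qed.

Lemma poly_X0_inj : injective poly_X0.
Proof. exact: can_inj poly_X0K. Qed.

(** The coefficient collects the monomials with exponent [j] in X_0, whose other variables carry the
    remaining degree. As [d - j] is truncated, the case d < j needs the second clause: degree 0
    alone would allow a nonzero constant. *)
Lemma poly_X0_coef_homog d (F : {mpoly k[n.+2]}) j :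
  F \is d.-homog -> ((poly_X0 F)`_j \is (d - j).-homog) /\
                    ((d < j)%N -> (poly_X0 F)`_j = 0).
Proof.
move=> hF; have E : (poly_X0 F)`_j =
  \sum_(t <- msupp F | t ord0 == j)
     F@_t *: 'X_[[multinom t (lift ord0 i) | i < n.+1]].
  rewrite [F in LHS]mpolyE rmorph_sum coef_sum big_mkcond [RHS]big_mkcond /=.
  apply: eq_bigr => t _; rewrite -mul_mpolyC rmorphM /= poly_X0C coefCM.
  rewrite mul_mpolyC mpolyXE_id rmorph_prod big_ord_recl rmorphXn /= poly_X0_X0.
  under eq_bigr do rewrite rmorphXn /= poly_X0_lift -polyC_exp.
  rewrite -rmorph_prod coefMC coefXn eq_sym.
  case: eqP => _; rewrite ?mul0r ?scaler0 // mul1r; congr (_ *: _).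
  by rewrite mpolyXE_id; apply: eq_bigr => i _; rewrite mnmE.
have deg t : t \in msupp F -> d = (t ord0 + mdeg [multinom t (lift ord0 i) | i < n.+1])%N.
  move=> /(dhomog_mf hF) /= <-; rewrite !mdegE big_ord_recl; congr (_ + _)%N.
  by apply: eq_bigr => i _; rewrite mnmE.
split; rewrite E.
  rewrite big_seq_cond; apply: rpred_sum => t /andP[/deg -> /eqP <-].
  by apply: dhomogZ; rewrite dhomogX addKn.
move=> lt_dj; rewrite big_seq_cond big1 // => t /andP[/deg ed /eqP et].
by move: lt_dj; rewrite ed et ltnNge leq_addr.
Qed.

End FirstVariable.

(** * Polynomials invariant under affine substitutions *)

(* For an indeterminate T the polynomial f(Y) - f(T) in Y has the pairwise
   distinct roots r_i(T), hence equals f_N * prod_i (Y - r_i(T)); put Y = 0. *)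
Lemma affine_invariant_factor (R : idomainType) (I : finType) (A : {set I})
    (r : I -> {poly R}) (f : {poly R}) :
  (0 < #|A|)%N -> {in A &, injective r} -> (size f <= #|A|.+1)%N ->
  {in A, forall i, f \Po r i = f} ->
  f = (- (-1) ^+ #|A| * f`_#|A|)%:P * \prod_(i in A) r i + (f`_0)%:P.
Proof.
move=> A0 r_inj sf fr; set N := #|A| in A0 sf *.
pose P := \prod_(z <- [seq r i | i <- enum A]) ('X - z%:P) : {poly {poly R}}.
have P1 : P`_N = 1.
  have /monicP := monic_prod_XsubC [seq r i | i <- enum A] xpredT id.
  by rewrite lead_coefE size_prod_XsubC size_map -cardE.
(* With Y the outer and T the inner indeterminate, [map_poly polyC f] is f(Y) and [f%:P] is f(T).
   Subtracting the multiple of [P] removes the term of degree [N]. *)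
pose D := map_poly polyC f - f%:P - (f`_N)%:P *: P.
have sD : (size D <= N)%N.
  apply/leq_sizeP => j le_Nj; rewrite !coefB coefZ coef_map coefC /=.
  (* Positivity of [N] matters here: f(T) contributes only to the coefficient of Y^0. *)
  rewrite gtn_eqF ?(leq_trans A0) // subr0.
  move: le_Nj; rewrite leq_eqVlt => /predU1P[<-|lt_Nj]; first by rewrite P1 mulr1 subrr.
  rewrite [f`_j]nth_default ?(leq_trans sf) // sub0r.
  rewrite (nth_default 0 (_ : size P <= j)%N) ?mulr0 ?oppr0 //.
  by rewrite size_prod_XsubC size_map -cardE.
have D0 : D = 0.
  apply/eqP/negPn/negP => /max_poly_roots maxD.
  suff /maxD lt_ND : all (root D) [seq r i | i <- enum A].
    have := lt_ND _; rewrite size_map -cardE ltnNge sD => H.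
    suff /H : uniq [seq r i | i <- enum A] by [].
    by rewrite map_inj_in_uniq ?enum_uniq // => i j; rewrite !mem_enum; exact: r_inj.
  apply/allP => z rz; apply/rootP.
  have Pz : P.[z] = 0 by apply/rootP; rewrite root_prod_XsubC.
  case/mapP: rz Pz => i; rewrite mem_enum => iA -> Pz.
  by rewrite !hornerE Pz -[_.[r i]]/(f \Po r i) fr // mulr0 !subrr.
have /eqP := congr1 (horner^~ 0) D0.
rewrite /= horner0 !hornerD !hornerN hornerZ hornerC horner_coef0 coef_map /= horner_prod.
rewrite big_map big_enum /=.
under eq_bigr do rewrite hornerXsubC sub0r.
rewrite prodrN -/N subr_eq0 subr_eq addrC -subr_eq => /eqP {1}<-.
by rewrite polyCM polyCN polyC_exp polyCN mulrCA mulrA mulNr mulNr addrC.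
Qed.

Lemma coef_linear (R : nzRingType) (a b : R) :
  (a%:P * 'X + b%:P)`_0 = b /\ (a%:P * 'X + b%:P)`_1 = a.
Proof. by rewrite !coefD !coefMX !coefC /= add0r addr0. Qed.

Lemma size_lead_linear (R : idomainType) (a b : R) : a != 0 ->
  size (a%:P * 'X + b%:P) = 2 /\ lead_coef (a%:P * 'X + b%:P) = a.
Proof.
move=> a0; suff s2 : size (a%:P * 'X + b%:P) = 2.
  by rewrite lead_coefE s2 (coef_linear _ _).2.
by rewrite size_MXaddC polyC_eq0 (negPf a0) size_polyC a0.
Qed.

(** The leading coefficient of the composite is that of [f] times [a] to the degree of [f], hence
    that of [f] itself; comparison with [c%:P * f] leaves c = 1. *)
Lemma comp_linear_scale (R : idomainType) (f : {poly R}) (a b c : R) :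
  a != 0 -> f != 0 -> a ^+ (size f).-1 = 1 ->
  f \Po (a%:P * 'X + b%:P) = c%:P * f -> f \Po (a%:P * 'X + b%:P) = f.
Proof.
move=> a0 f0 a1 e; have [s2 lq] := size_lead_linear b a0.
have := congr1 lead_coef e.
rewrite lead_coef_comp ?s2 // lq a1 mulr1 mul_polyC lead_coefZ.
rewrite -{1}[lead_coef f]mul1r => /mulIf c1.
by rewrite e -c1 ?lead_coef_eq0 // mul1r.
Qed.

(** * Upper triangular matrices as affine substitutions in X_0 *)

Section UpperTriangular.

Variables (k : fieldType) (n : nat).
Implicit Types g : 'M[k]_n.+2.

Lemma block_mx_fstE (a : k) (b : 'rV[k]_n.+1) :
  let M := block_mx (a%:M : 'M_1) b 0 (1%:M : 'M_n.+1) in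
  M ord0 ord0 = a /\ forall i j, M (lift ord0 i) j = (lift ord0 i == j)%:R.
Proof.
have e0 : ord0 = lshift n.+1 (ord0 : 'I_1) by apply: val_inj.
have eS (i : 'I_n.+1) : lift ord0 i = rshift 1 i by apply: val_inj.
split=> [|i j]; first by rewrite e0 block_mxEul mxE.
case: (unliftP ord0 j) => [j'|] ->; rewrite eS; last first.
  by rewrite e0 block_mxEdl mxE -val_eqE.
by rewrite eS block_mxEdr mxE -!val_eqE.
Qed.

Lemma in_UT_row g i j : in_UT g -> g (lift ord0 i) j = (lift ord0 i == j)%:R.
Proof. by case=> a [b [_ ->]]; case: (block_mx_fstE a b). Qed.

Lemma in_UT_corner g : in_UT g -> g ord0 ord0 != 0.
Proof. by case=> a [b [a0 ->]]; case: (block_mx_fstE a b) => ->. Qed.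

(** Below the corner the first column of [g2] is zero, so a single term of the matrix product
    survives. This makes the corner a character on groups of such matrices. *)
Lemma in_UT_cornerM g1 g2 : in_UT g2 ->
  (g1 *m g2) ord0 ord0 = g1 ord0 ord0 * g2 ord0 ord0.
Proof.
move=> T2; rewrite mxE big_ord_recl big1 ?addr0 // => i _.
by rewrite in_UT_row // -val_eqE mulr0.
Qed.

Lemma linear_map_lift g i : in_UT g -> tnth (linear_map g) (lift ord0 i) = 'X_(lift ord0 i).
Proof.
move=> Tg; rewrite tnth_mktuple (bigD1 (lift ord0 i)) //= in_UT_row // eqxx scale1r.
by rewrite big1 ?addr0 // => j /negPf nj; rewrite in_UT_row // eq_sym nj scale0r.
Qed.

Lemma pullback_X0 g : pullback g 'X_ord0 = tnth (linear_map g) ord0.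
Proof. by rewrite /pullback comp_mpolyXU (tnth_nth 0). Qed.

Definition shift_form g : {mpoly k[n.+1]} :=
  \sum_(j < n.+1) g ord0 (lift ord0 j) *: 'X_j.

Definition affine g : {poly {mpoly k[n.+1]}} :=
  ((g ord0 ord0)%:MP)%:P * 'X + (shift_form g)%:P.

Lemma poly_X0_linear g : poly_X0 (tnth (linear_map g) ord0) = affine g.
Proof.
have Z c F : poly_X0 (c *: F) = (c%:MP)%:P * poly_X0 F :> {poly {mpoly k[n.+1]}}.
  by rewrite -mul_mpolyC rmorphM /= poly_X0C.
rewrite tnth_mktuple big_ord_recl rmorphD /= Z poly_X0_X0; congr (_ + _).
rewrite /shift_form !rmorph_sum; apply: eq_bigr => j _.
by rewrite /= Z poly_X0_lift -mul_mpolyC polyCM.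
Qed.

Lemma poly_X0_pullback_X0 g : poly_X0 (pullback g 'X_ord0) = affine g.
Proof. by rewrite pullback_X0 poly_X0_linear. Qed.

(** A matrix of this shape fixes X_1, ..., X_(n+1), so its pullback is linear over
    k[X_1, ..., X_(n+1)] and moves only X_0. *)
Lemma poly_X0_pullback g (F : {mpoly k[n.+2]}) : in_UT g ->
  poly_X0 (pullback g F) = poly_X0 F \Po affine g.
Proof.
move=> Tg.
pose R0 := {mpoly k[n.+1]}.
pose u : {rmorphism {mpoly k[n.+2]} -> {poly R0}} := @poly_X0 k n \o comp_mpoly (linear_map g).
pose v : {rmorphism {mpoly k[n.+2]} -> {poly R0}} := comp_poly (affine g) \o @poly_X0 k n.
apply: (mpoly_morph_ext (f := u) (g := v)) => [c|i].
  by rewrite /u /v /= comp_mpolyC !poly_X0C comp_polyC.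
rewrite /u /v /=.
rewrite comp_mpolyXU -tnth_nth.
case: (unliftP ord0 i) => [j|] ->.
  by rewrite linear_map_lift // poly_X0_lift comp_polyC.
by rewrite poly_X0_linear poly_X0_X0 comp_polyX.
Qed.

Lemma affine_coef1 g : (affine g)`_1 = (g ord0 ord0)%:MP.
Proof. exact: (coef_linear _ _).2. Qed.

Lemma affine_coef0 g : (affine g)`_0 = shift_form g.
Proof. exact: (coef_linear _ _).1. Qed.

Lemma mcoeff_shift_form g j : (shift_form g)@_U_(j) = g ord0 (lift ord0 j).
Proof.
rewrite /shift_form raddf_sum (bigD1 j) //=.
rewrite mcoeffZ mcoeffX eqxx mulr1 big1 ?addr0 // => i ne.
by rewrite mcoeffZ mcoeffX eq_mnm1 (negPf ne) mulr0.
Qed.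

(** The two coefficients of [affine g] recover the first row of [g]; the remaining rows are common
    to all matrices of this shape. *)
Lemma affine_inj g1 g2 : in_UT g1 -> in_UT g2 -> affine g1 = affine g2 -> g1 = g2.
Proof.
move=> T1 T2 e; apply/matrixP => i j.
case: (unliftP ord0 i) => [i'|] ->; first by rewrite !in_UT_row.
case: (unliftP ord0 j) => [j'|] ->; first by rewrite -!mcoeff_shift_form -!affine_coef0 e.
by apply/eqP; rewrite -(@mpolyC_eq n.+1 k); apply/eqP; rewrite -!affine_coef1 e.
Qed.

Lemma comp_affine_scale g (f : {poly {mpoly k[n.+1]}}) (c : k) : in_UT g -> f != 0 ->
  g ord0 ord0 ^+ (size f).-1 = 1 -> f \Po affine g = (c%:MP)%:P * f ->
  f \Po affine g = f.
Proof.
move=> /in_UT_corner g0 f0 g1; apply: comp_linear_scale => //.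
  by rewrite mpolyC_eq0.
by rewrite -rmorphXn g1.
Qed.

End UpperTriangular.

(** * Dehomogenization *)

Section Dehomogenization.

Variables (k : fieldType) (N : nat) (R : idomainType).
Variable q : {rmorphism {mpoly k[N]} -> R}.
Local Notation E := (proj_field q).

Lemma val_homog_quot e a b : a \is e.-homog -> b \is e.-homog -> q b != 0 ->
  val (homog_quot q a b) = tofrac (q a) / tofrac (q b).
Proof.
by move=> ha hb qb; rewrite /homog_quot insubdK //; apply/asboolP; exists e, a, b.
Qed.

Lemma proj_field_quot (z : E) : exists e a b,
  [/\ a \is e.-homog, b \is e.-homog, q b != 0 & z = homog_quot q a b].
Proof.
have /asboolP[e [a [b [ha hb b0 ez]]]] := valP z.
by exists e, a, b; split=> //; apply: val_inj; rewrite (val_homog_quot ha hb b0).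
Qed.

Definition proj_const (c : k) : E := homog_quot q c%:MP 1.

Lemma dhomogC (c : k) : c%:MP_[N] \is 0.-homog.
Proof. by rewrite -[_%:MP]mulr1 mul_mpolyC; apply: dhomogZ; exact: dhomog1. Qed.

Lemma val_proj_const c : val (proj_const c) = tofrac (q c%:MP).
Proof.
rewrite (val_homog_quot (dhomogC c)) ?dhomog1 ?rmorph1 ?oner_eq0 //.
by rewrite ?rmorph1 divr1.
Qed.

Lemma proj_const_zmod : zmod_morphism proj_const.
Proof. by move=> c d; apply: val_inj; rewrite rmorphB /= !val_proj_const !rmorphB. Qed.

Lemma proj_const_monoid : monoid_morphism proj_const.
Proof.
split=> [|c d]; apply: val_inj; first by rewrite val_proj_const !rmorph1.
by rewrite rmorphM /= !val_proj_const !rmorphM.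
Qed.

HB.instance Definition _ := GRing.isZmodMorphism.Build k E proj_const proj_const_zmod.
HB.instance Definition _ := GRing.isMonoidMorphism.Build k E proj_const proj_const_monoid.

Variable j : 'I_N.
Hypothesis qj : q 'X_j != 0.

Definition affine_coord (i : 'I_N) : E := homog_quot q 'X_i 'X_j.

(** Substitutes X_i/X_j for X_i; congruences of forms modulo the kernel of [q] become identities in
    a field. *)
Definition dehom : {mpoly k[N]} -> E := mmap proj_const affine_coord.

HB.instance Definition _ := GRing.RMorphism.on dehom.

Lemma dhomogX1 (i : 'I_N) : 'X_i \is [in k[N], 1.-homog].
Proof. by rewrite dhomogX; apply/eqP/mdeg1. Qed.

Lemma val_affine_coord i : val (affine_coord i) = tofrac (q 'X_i) / tofrac (q 'X_j).
Proof. by apply: val_homog_quot qj; apply: dhomogX1. Qed.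

Lemma dehomX i : dehom 'X_i = affine_coord i.
Proof. by rewrite /dehom mmapX mmap1U. Qed.

Lemma dehom_base : dehom 'X_j = 1.
Proof. by rewrite dehomX; apply: val_inj; rewrite val_affine_coord divff ?tofrac_eq0. Qed.

(** Since X_i = X_j (X_i/X_j), each monomial of degree [e] releases the factor X_j^e. *)
Lemma tofrac_dehom e G : G \is e.-homog ->
  tofrac (q G) = tofrac (q 'X_j) ^+ e * val (dehom G).
Proof.
move=> hG; have t0 : tofrac (q 'X_j) != 0 by rewrite tofrac_eq0.
pose v : {rmorphism E -> {fraction R}} := val.
pose t : {rmorphism {mpoly k[N]} -> {fraction R}} := @tofrac R \o q.
rewrite -[LHS]/(t G) -[val _]/(v (dehom G)) [LHS]mpoly_morphE /dehom rmorph_mmap.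
rewrite -(mmap_homog_scale _ _ _ hG); apply: mmap_ext => [c|i] /=.
  by rewrite /v /= val_proj_const.
by rewrite /v /= val_affine_coord mulrC divfK.
Qed.

Lemma dehom_eq0 e G : G \is e.-homog -> (dehom G == 0) = (q G == 0).
Proof.
move=> hG; rewrite -(tofrac_eq0 (q G)) (tofrac_dehom hG) mulf_eq0 expf_eq0 tofrac_eq0.
by rewrite (negPf qj) andbF /= -(inj_eq val_inj) rmorph0.
Qed.

Lemma homog_quotE e a b : a \is e.-homog -> b \is e.-homog -> q b != 0 ->
  homog_quot q a b = dehom a / dehom b.
Proof.
move=> ha hb qb; have db : dehom b != 0 by rewrite (dehom_eq0 hb).
apply: (mulIf db); rewrite divfK //; apply: val_inj; rewrite rmorphM /=.
rewrite (val_homog_quot ha hb qb) (tofrac_dehom ha) (tofrac_dehom hb).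
by rewrite -mulf_div divff ?expf_neq0 ?tofrac_eq0 // mul1r divfK.
Qed.

Lemma dehom_comp M (G : {mpoly k[M]}) (phi : M.-tuple {mpoly k[N]}) :
  dehom (G \mPo phi) = mmap proj_const (fun i => dehom (tnth phi i)) G.
Proof.
rewrite (morph_comp_mpoly dehom); apply: mmap_ext => // c /=.
by rewrite /dehom mmapC.
Qed.

End Dehomogenization.

(** * Birational maps from field automorphisms *)

Section HypersurfaceIdeal.

Variables (k : fieldType) (n d : nat) (X : hypersurface k n d).

Lemma coord_proj_eq0 G : (coord_proj X G == 0) = (G \in hyp_ideal X).
Proof. by rewrite -{2}[G]subr0 Quotient.idealrBE -(rmorph0 (@coord_proj k n d X)). Qed.

(** Degrees in X_0 add up in a product. The ideal therefore has no nonzero element of smaller degree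
    in X_0 than the defining form. *)
Lemma hyp_ideal_size G : G \in hyp_ideal X -> G != 0 ->
  (size (poly_X0 (defpoly X)) <= size (poly_X0 G))%N.
Proof.
case/asboolP => Q -> nz; have : poly_X0 (Q * defpoly X) != 0.
  by rewrite -(rmorph0 (@poly_X0 k n)) (inj_eq (@poly_X0_inj k n)).
rewrite rmorphM /= => nz'; rewrite size_mul.
- rewrite -subn1 -addnBAC ?leq_addl // lt0n size_poly_eq0.
  by apply: contraNneq nz' => ->; rewrite mul0r.
- by apply: contraNneq nz' => ->; rewrite mul0r.
- by apply: contraNneq nz' => ->; rewrite mulr0.
Qed.

(** X_1 has degree 0 in X_0, too small for the ideal. Hence X_1 can serve as the denominator of the
    affine coordinates. *)
Lemma X1_neq0 : (1 < size (poly_X0 (defpoly X)))%N ->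
  coord_proj X 'X_(lift ord0 ord0) != 0.
Proof.
rewrite coord_proj_eq0; apply: contraL => /hyp_ideal_size H.
rewrite -leqNgt (leq_trans (H _)) //; last by rewrite poly_X0_lift size_polyC_leq1.
by rewrite -msupp_eq0 msuppX.
Qed.

End HypersurfaceIdeal.

Section GaloisGroup.

Variables (k : fieldType) (n d : nat) (X : hypersurface k n d).
(* R is the coordinate ring of X, used only through the kernel of q. *)
Variables (R : idomainType) (q : {rmorphism {mpoly k[n.+2]} -> R}).
Local Notation E := (proj_field q).
Local Notation j := (@lift n.+2 ord0 ord0).
Hypothesis ker_q : forall G, (q G == 0) = (G \in hyp_ideal X).
Hypothesis X1_neq0 : q 'X_j != 0.

Local Notation y := (affine_coord q j).
Local Notation dh := (dehom q j).

Lemma affine_coord_base : y j = 1.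
Proof. by rewrite -dehomX dehom_base ?X1_neq0. Qed.

Lemma dehom_hyp e G : G \is e.-homog -> (dh G == 0) = (G \in hyp_ideal X).
Proof. by move=> hG; rewrite (dehom_eq0 X1_neq0 hG) ker_q. Qed.

(** The constants and the quotients X_i/X_1 with i >= 1 generate k(P^n), so for a field morphism [s]
    this means being the identity on k(P^n). *)
Definition fixes_Pn (s : E -> E) : Prop :=
  (forall c, s (proj_const q c) = proj_const q c) /\
  (forall i, s (y (lift ord0 i)) = y (lift ord0 i)).

(* The tuple phi of forms of degree e is the rational self-map of X whose
   pullback is s. *)
Definition induces (s : E -> E) (phi : (n.+2).-tuple {mpoly k[n.+2]}) e (c : E) : Prop :=
  [/\ forall i, tnth phi i \is e.-homog, c != 0 & forall i, dh (tnth phi i) = c * s (y i)].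

(** As [s] fixes the constants, it commutes with evaluating [G]; each variable brings one factor
    [c], and homogeneity collects them. *)
Lemma dehom_induced (s : {rmorphism E -> E}) phi e c f G :
  fixes_Pn s -> induces s phi e c -> G \is f.-homog ->
  dh (G \mPo phi) = c ^+ f * s (dh G).
Proof.
move=> [sc _] [_ _ sphi] hG; rewrite dehom_comp rmorph_mmap -(mmap_homog_scale _ _ _ hG).
by apply: mmap_ext => [b|i] /=; rewrite ?sc ?sphi.
Qed.

(** If s(X_0/X_1) = a/b with forms of equal degree, then [a X_1 : b X_1 : ... : b X_(n+1)] has
    pullback [s], the common factor coming from [b]. *)
Lemma exists_induced (s : {rmorphism E -> E}) : fixes_Pn s ->
  exists phi e c, induces s phi e c.
Proof.
move=> [_ sy]; have [e [a [b [ha hb qb es]]]] := proj_field_quot (s (y ord0)).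
exists [tuple (if unlift ord0 i is Some _ then b * 'X_i else a * 'X_j) | i < n.+2].
exists (e + 1)%N, (dh b); split=> [i||i].
- by rewrite tnth_mktuple; case: unlift => [_|]; apply: dhomogM => //; apply: dhomogX1.
- by rewrite (dehom_eq0 X1_neq0 hb).
rewrite tnth_mktuple; case: (unliftP ord0 i) => [i' ->|->].
  by rewrite sy rmorphM /= dehomX.
rewrite es (homog_quotE X1_neq0 ha hb qb) rmorphM /= dehomX affine_coord_base mulr1.
by rewrite mulrC divfK // (dehom_eq0 X1_neq0 hb).
Qed.

Lemma represents_intro M (phi : M.-tuple {mpoly k[n.+2]}) e i :
  (forall i, tnth phi i \is e.-homog) -> dh (tnth phi i) != 0 ->
  represents_rational_map X phi.
Proof.
by move=> hphi nz; split; [exists e|exists i; rewrite -(dehom_hyp (hphi i))].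
Qed.

(** After dehomogenization both tuples are multiples of one nonzero vector [z], so all their 2 x 2
    minors vanish on X. *)
Lemma same_map_intro M (phi psi : M.-tuple {mpoly k[n.+2]}) e f (z : 'I_M -> E) a b i :
  (forall i, tnth phi i \is e.-homog) -> (forall i, tnth psi i \is f.-homog) ->
  a != 0 -> b != 0 -> z i != 0 ->
  (forall i, dh (tnth phi i) = a * z i) -> (forall i, dh (tnth psi i) = b * z i) ->
  same_rational_map X phi psi.
Proof.
move=> hphi hpsi a0 b0 z0 ephi epsi; split.
- by apply: (represents_intro (i := i) hphi); rewrite ephi mulf_neq0.
- by apply: (represents_intro (i := i) hpsi); rewrite epsi mulf_neq0.
move=> u v; rewrite -(@dehom_hyp (e + f)); last first.
  by rewrite rpredB //; apply: dhomogM.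
by rewrite rmorphB !rmorphM /= !ephi !epsi mulrACA [X in _ - X]mulrACA [z v * _]mulrC subrr.
Qed.

(** Pullback reverses composition: the coordinates of the composite dehomogenize to a^f s(b)
    s(t(y_i)), and s(t(y_i)) = y_i. *)
Lemma comp_induced (s t : {rmorphism E -> E}) phi psi e f a b :
  fixes_Pn s -> cancel t s -> induces s phi e a -> induces t psi f b ->
  same_rational_map X (comp_map psi phi) (@id_map k n).
Proof.
move=> fs ts iphi ipsi; have [hphi a0 _] := iphi; have [hpsi b0 epsi] := ipsi.
apply: (@same_map_intro _ _ _ (e * f)%N 1 y (a ^+ f * s b) 1 j) => [i|i|||||i].
- by rewrite tnth_mktuple; apply: dhomog_comp_mpoly.
- by rewrite tnth_mktuple dhomogX1.
- by rewrite mulf_neq0 ?expf_neq0 ?fmorph_eq0.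
- exact: oner_neq0.
- by rewrite affine_coord_base oner_neq0.
- move=> i; rewrite tnth_mktuple (dehom_induced fs iphi (hpsi i)) epsi.
  by rewrite rmorphM /= ts mulrA.
- by rewrite tnth_mktuple dehomX mul1r.
Qed.

Lemma induced_self_map (s : {rmorphism E -> E}) phi e a :
  fixes_Pn s -> induces s phi e a -> rational_self_map X phi.
Proof.
move=> fs iphi; have [hphi a0 ephi] := iphi; split.
  apply: (represents_intro (i := j) hphi).
  by rewrite ephi affine_coord_base rmorph1 mulr1.
rewrite -(dehom_hyp (dhomog_comp_mpoly (defpoly_homog X) hphi)).
rewrite (dehom_induced fs iphi (defpoly_homog X)).
have /eqP -> : dh (defpoly X) == 0.
  rewrite (dehom_hyp (defpoly_homog X)); apply/asboolP; exists 1.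
  by rewrite mul1r.
by rewrite rmorph0 mulr0.
Qed.

(** A map induced by [t] is the birational inverse, and the projection is unchanged because [s]
    fixes X_i/X_1 for i >= 1. *)
Lemma induced_galois (s t : {rmorphism E -> E}) phi e a :
  fixes_Pn s -> fixes_Pn t -> cancel s t -> cancel t s ->
  induces s phi e a -> in_galois_group X phi.
Proof.
move=> fs ft st ts iphi; have [hphi a0 ephi] := iphi.
have [psi [f [b ipsi]]] := exists_induced ft; split.
  split; first exact: induced_self_map iphi.
  exists psi; split; first exact: induced_self_map ipsi.
    exact: (comp_induced fs ts iphi ipsi).
  exact: (comp_induced ft st ipsi iphi).
apply: (@same_map_intro _ _ _ e 1 (fun i => y (lift ord0 i)) a 1 ord0) => // [i|i|||i|i].
- by rewrite !tnth_mktuple comp_mpolyXU -tnth_nth.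
- by rewrite tnth_mktuple dhomogX1.
- exact: oner_neq0.
- by rewrite affine_coord_base oner_neq0.
- by rewrite !tnth_mktuple comp_mpolyXU -tnth_nth ephi (proj2 fs).
- by rewrite tnth_mktuple dehomX mul1r.
Qed.

(** The minors against the coordinate X_1, where s(X_1/X_1) = 1, show that [psi] is its own
    X_1-component times the s(y_i). Were that component zero on X, all of [psi] would be. *)
Lemma induces_same_map (s : {rmorphism E -> E}) phi psi e a :
  induces s phi e a -> same_rational_map X phi psi -> exists f b, induces s psi f b.
Proof.
move=> [hphi a0 ephi] [_ [[f hpsi] [i0 nz]] cross]; exists f, (dh (tnth psi j)).
have ye i : dh (tnth psi i) = dh (tnth psi j) * s (y i).
  have := cross i j; rewrite -(@dehom_hyp (e + f)); last first.
    by rewrite rpredB //; apply: dhomogM.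
  rewrite rmorphB !rmorphM /= !ephi affine_coord_base rmorph1 mulr1 subr_eq0 -mulrA.
  by move=> /eqP /(mulfI a0) <-; rewrite mulrC.
split=> //; apply: contraNneq nz => z.
by rewrite -(dehom_hyp (hpsi i0)) ye z mul0r.
Qed.

Lemma extendable_induced (s t : {rmorphism E -> E}) :
  extendable X -> fixes_Pn s -> fixes_Pn t -> cancel s t -> cancel t s ->
  exists A : 'M[k]_n.+2, in_galois_PGL X A /\ exists e c, induces s (linear_map A) e c.
Proof.
move=> ext fs ft st ts; have [phi [e [a iphi]]] := exists_induced fs.
have [A [uA pA phiA]] := ext phi (induced_galois fs ft st ts iphi).
have iA := induces_same_map iphi phiA; exists A; split=> //; split=> //.
by have [f [b iAfb]] := iA; exact: (induced_galois fs ft st ts iAfb).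
Qed.

(** [A] is a scalar multiple of [g], and [g] fixes X_1; comparing the X_1-components identifies the
    scalar with [c], which then cancels in the X_0-component. *)
Lemma in_UT_induced (s : {rmorphism E -> E}) A g e c :
  induces s (linear_map A) e c -> same_PGL A g -> in_UT g ->
  s (y ord0) = dh (tnth (linear_map g) ord0).
Proof.
move=> [_ c0 eA] [a [a0 eAg]] Tg.
have lin i : dh (tnth (linear_map A) i) = proj_const q a * dh (tnth (linear_map g) i).
  have -> : tnth (linear_map A) i = a%:MP * tnth (linear_map g) i.
    rewrite !tnth_mktuple eAg mul_mpolyC scaler_sumr.
    by apply: eq_bigr => l _; rewrite mxE scalerA.
  by rewrite rmorphM /= /dehom mmapC.
have := lin j; rewrite eA linear_map_lift // dehomX affine_coord_base rmorph1 !mulr1 => ec.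
by apply: (mulfI c0); rewrite -eA lin ec.
Qed.

End GaloisGroup.

(** * The degree of the projection *)

Lemma dhomog_bigprod (k : fieldType) N (I : finType) (P : pred I)
    (e : I -> nat) (b : I -> {mpoly k[N]}) :
  (forall i, b i \is (e i).-homog) ->
  \prod_(i | P i) b i \is (\sum_(i | P i) e i).-homog.
Proof.
move=> hb; elim/big_rec2: _ => [|i f G _ hG]; first exact: dhomog1.
exact: dhomogM.
Qed.

Lemma rmorphism_of (R S : nzRingType) (s : R -> S) :
  zmod_morphism s -> monoid_morphism s -> exists t : {rmorphism R -> S}, t =1 s.
Proof.
move=> sB sM.
pose a := GRing.isZmodMorphism.Build R S s sB.
pose m := GRing.isMonoidMorphism.Build R S s sM.
pose t : {rmorphism R -> S} := HB.pack s a m.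
by exists t.
Qed.

Section Degree.

Variables (k : fieldType) (n d : nat) (X : hypersurface k n d).
Variables (R : idomainType) (q : {rmorphism {mpoly k[n.+2]} -> R}).
Local Notation K := (function_field_Pn k n).
Local Notation E := (proj_field q).
Local Notation j := (@lift n.+2 ord0 ord0).
Local Notation y := (affine_coord q j).
Local Notation dh := (dehom q j).
Hypothesis ker_q : forall G, (q G == 0) = (G \in hyp_ideal X).
Hypothesis size_X : (1 < size (poly_X0 (defpoly X)))%N.
Hypothesis X1_neq0 : q 'X_j != 0.
Variable i : {rmorphism K -> E}.
Hypothesis i_pull : forall e (a b : {mpoly k[n.+1]}),
  a \is e.-homog -> b \is e.-homog -> b != 0 ->
  i (homog_quot idfun a b) = homog_quot q (piP_pull a) (piP_pull b).

(** A form pulled back from P^n has degree 0 in X_0, too small for the ideal; this is the dominance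
    of the projection. *)
Lemma piP_pull_neq0 (b : {mpoly k[n.+1]}) : b != 0 -> q (piP_pull b) != 0.
Proof.
move=> b0; rewrite ker_q; apply: contraL size_X => /hyp_ideal_size H.
rewrite -leqNgt (leq_trans (H _)) //; last by rewrite poly_X0_pull size_polyC_leq1.
apply: contraNneq b0 => z; have := poly_X0_pull b.
by rewrite z rmorph0 => /esym/eqP; rewrite polyC_eq0.
Qed.

(** The degree and the two forms are packed into one witness, so that [choice] can select them for
    all coefficients of a polynomial at once. *)
Lemma piP_pullback_quot (c : K) : exists t : nat * ({mpoly k[n.+1]} * {mpoly k[n.+1]}),
  [/\ t.2.1 \is t.1.-homog, t.2.2 \is t.1.-homog, t.2.2 != 0, c = homog_quot idfun t.2.1 t.2.2
    & i c = dh (piP_pull t.2.1) / dh (piP_pull t.2.2)].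
Proof.
have [e [a [b [ha hb b0 ec]]]] := proj_field_quot c.
exists (e, (a, b)); split=> //=.
rewrite ec (i_pull ha hb b0).
by apply: (homog_quotE X1_neq0 (dhomog_piP_pull ha) (dhomog_piP_pull hb)); apply: piP_pull_neq0.
Qed.

(** An equation for X_0/X_1 over k(P^n), cleared of denominators and homogenized with X_1, is a
    nonzero form in the ideal of X, and its degree in X_0 cannot be below that of the defining
    form. *)
Lemma affine_coord_degree (p : {poly K}) : p != 0 ->
  (map_poly i p).[y ord0] = 0 -> (size (poly_X0 (defpoly X)) <= size p)%N.
Proof.
move=> p0 rp; set s := size p.
have [t tP] := choice (fun l => piP_pullback_quot p`_l).
pose e l := (t l).1; pose a l := (t l).2.1; pose b l := (t l).2.2.
pose A (l : 'I_s) := a l * \prod_(l' < s | l' != l) b l'.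
(* Inside [piP_pull] the variable ['X_ord0] stands for X_1, outside for X_0. The power of X_1 gives
   all terms the same degree. *)
pose H := \sum_(l < s) piP_pull (A l * 'X_ord0 ^+ (s.-1 - l)) * 'X_ord0 ^+ l.
have hA l : A l \is (\sum_(l' < s) e l').-homog.
  rewrite (bigD1 l) //=; apply: dhomogM; first by case: (tP l).
  by apply: (@dhomog_bigprod _ _ _ _ (fun l' : 'I_s => e l')) => l'; case: (tP (nat_of_ord l')).
have hXn N (v : 'I_N) m : 'X_v ^+ m \is [in k[N], m.-homog].
  by rewrite -[m in m.-homog]mul1n; apply: dhomogMn; apply: dhomogX1.
have hH : H \is (\sum_(l' < s) e l' + s.-1).-homog.
  apply: rpred_sum => l _; have le_l : (l <= s.-1)%N.
    by rewrite -ltnS prednK // (leq_ltn_trans _ (ltn_ord l)).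
  have -> : (\sum_(l' < s) e l' + s.-1 = \sum_(l' < s) e l' + (s.-1 - l) + l)%N.
    by rewrite -addnA subnK.
  apply: dhomogM; last exact: hXn.
  by apply/dhomog_piP_pull/dhomogM; [exact: hA|exact: hXn].
have dhb l : dh (piP_pull (b l)) != 0.
  have [_ hb b0 _ _] := tP l; rewrite (dehom_eq0 X1_neq0 (dhomog_piP_pull hb)).
  exact: piP_pull_neq0.
(* X_1 dehomogenizes to 1, so the padding disappears and only the product of all denominators
   remains as a factor. *)
have dH : dh H = (\prod_(l < s) dh (piP_pull (b l))) * (map_poly i p).[y ord0].
  rewrite horner_coef size_map_poly mulr_sumr rmorph_sum; apply: eq_bigr => l _.
  rewrite coef_map /= !rmorphM !rmorphXn /= piP_pullX !dehomX affine_coord_base // expr1n mulr1.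
  rewrite mulrA; congr (_ * _); rewrite !rmorph_prod [in RHS](bigD1 l) //=.
  have [_ _ _ _ ->] := tP l; rewrite -/(a l) -/(b l).
  by rewrite [RHS]mulrC mulrA divfK.
have poly_H : poly_X0 H = \sum_(l < s) (A l * 'X_ord0 ^+ (s.-1 - l))%:P * 'X^l.
  rewrite rmorph_sum; apply: eq_bigr => l _.
  by rewrite rmorphM rmorphXn /= poly_X0_X0 poly_X0_pull.
have sH : (size (poly_X0 H) <= s)%N.
  rewrite poly_H; apply: (leq_trans (size_sum _ _ _)); apply/bigmax_leqP => l _.
  rewrite mul_polyC (leq_trans (size_scale_leq _ _)) // size_polyXn.
  exact: ltn_ord.
apply: leq_trans sH; apply: hyp_ideal_size.
  by rewrite -ker_q -(dehom_eq0 X1_neq0 hH) dH rp mulr0.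
have s0 : (0 < s)%N by rewrite size_poly_gt0.
have lt_s : (s.-1 < s)%N by rewrite prednK.
pose m := Ordinal lt_s.
(* [H] is nonzero: its top coefficient comes from the leading coefficient of [p], with padding
   exponent 0. *)
have : (poly_X0 H)`_s.-1 = A m.
  rewrite poly_H coef_sum (bigD1 m) //= coefCM coefXn eqxx mulr1 subnn mulr1.
  rewrite big1 ?addr0 // => l ne; rewrite coefCM coefXn.
  rewrite (negPf (_ : s.-1 != l)) ?mulr0 // eq_sym.
  by apply: contraNneq ne => e'; apply/eqP/val_inj.
move=> eA; apply: contra_eqN eA => /eqP ->; rewrite rmorph0 coef0 eq_sym.
apply: mulf_neq0.
  apply: contraNneq p0 => z; rewrite -lead_coef_eq0 lead_coefE -/s.
  have [_ _ _ -> _] := tP s.-1; rewrite -/(a s.-1) [a _]z.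
  by rewrite /homog_quot rmorph0 mul0r; apply/eqP/val_inj; rewrite insubdK // rpred0.
by apply/prodf_neq0 => l _; case: (tP l).
Qed.

End Degree.

(** * Galois conjugates of X_0/X_1 *)

Section Counting.

Variables (k : fieldType) (n d : nat) (X : hypersurface k n d).
Variables (R : idomainType) (q : {rmorphism {mpoly k[n.+2]} -> R}).
Local Notation K := (function_field_Pn k n).
Local Notation E := (proj_field q).
Local Notation j := (@lift n.+2 ord0 ord0).
Local Notation y := (affine_coord q j).
Hypothesis ker_q : forall G, (q G == 0) = (G \in hyp_ideal X).
Hypothesis size_X : (1 < size (poly_X0 (defpoly X)))%N.
Hypothesis X1_neq0 : q 'X_j != 0.
Variable i : {rmorphism K -> E}.
Hypothesis i_pull : forall e (a b : {mpoly k[n.+1]}),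
  a \is e.-homog -> b \is e.-homog -> b != 0 ->
  i (homog_quot idfun a b) = homog_quot q (piP_pull a) (piP_pull b).

(** The constants and the quotients X_i/X_1 with i >= 1 are themselves pullbacks of rational
    functions on P^n. *)
Lemma fixes_Pn_pullback (s : E -> E) : (forall c, s (i c) = i c) -> fixes_Pn s.
Proof.
move=> si; split=> [c|l].
  have -> : proj_const q c = i (homog_quot idfun c%:MP 1).
    by rewrite (i_pull (@dhomogC k n.+1 c)) ?dhomog1 ?oner_neq0 // piP_pullC rmorph1.
  by rewrite si.
have -> : y (lift ord0 l) = i (homog_quot idfun 'X_l 'X_ord0).
  rewrite (i_pull (dhomogX1 _ _) (dhomogX1 _ _)) ?piP_pullX //.
  by rewrite -msupp_eq0 msuppX.
by rewrite si.
Qed.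

(* The conjugates of X_0/X_1 are the roots of its minimal polynomial, whose
   degree is at least the degree of X in X_0. *)
Lemma conjugates_bound (S : seq E) : galois_extension i ->
  (forall s t : {rmorphism E -> E}, fixes_Pn s -> fixes_Pn t ->
     cancel s t -> cancel t s -> s (y ord0) \in S) ->
  (size (poly_X0 (defpoly X)) <= (size S).+1)%N.
Proof.
move=> [L [f [[g fK gK] fi gal]]] HS; pose x := g (y ord0).
have [r [/subsetP rG r_uniq minx]] := elimT (galois_factors (sub1v _)) gal x (memvf x).
(* The inverse of [f] is again a morphism, so Galois automorphisms of [L] can be transported to
   [E]. *)
have gB : zmod_morphism g by move=> a b; apply: (can_inj fK); rewrite gK rmorphB !gK.
have gM : monoid_morphism g.
  split=> [|a b]; apply: (can_inj fK); first by rewrite gK rmorph1.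
  by rewrite gK rmorphM !gK.
have [g' eg] := rmorphism_of gB gM.
have conj (u : gal_of {:L}) : u \in ('Gal({:L} / 1))%g ->
    exists s : {rmorphism E -> E}, s =1 f \o u \o g /\ fixes_Pn s.
  move=> uG; pose s : {rmorphism E -> E} := f \o u \o g'.
  have es : s =1 f \o u \o g by move=> a; rewrite /s /= eg.
  exists s; split=> //; apply: fixes_Pn_pullback => c; rewrite es /= -fi fK.
  by rewrite (fixed_gal (sub1v _) uG) // rpredZ // rpred1.
have inS : {subset [seq f z | z <- [seq u x | u : gal_of {:L} <- r]] <= S}.
  move=> _ /mapP[_ /mapP[u ur ->] ->].
  have [s [es fs]] := conj u (rG u ur).
  (* The inverse of [u] supplies the inverse morphism that [HS] asks for. *)
  have [t [et ft]] := conj (u^-1)%g (groupVr (rG u ur)).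
  have -> : f (u x) = s (y ord0) by rewrite es.
  apply: (HS s t) => // a; rewrite ?es ?et /= ?es ?et /= fK -galM ?memvf //.
    by rewrite mulgV gal_id gK.
  by rewrite mulVg gal_id gK.
have size_r : (size r <= size S)%N.
  rewrite -(size_map (fun u : gal_of {:L} => u x)) -(size_map f).
  by apply: uniq_leq_size inS; rewrite map_inj_uniq //; exact: can_inj fK.
(* The minimal polynomial of [x] descends to [p] over k(P^n), and its degree is the number of
   conjugates. *)
have /polyOver1P[p ep] := minPolyOver 1 x.
have size_p : size p = (size r).+1.
  by rewrite -(size_map_poly (in_alg L)) -ep minx size_prod_XsubC size_map.
apply: leq_trans (_ : size p <= _)%N; last by rewrite size_p.
apply: (affine_coord_degree ker_q size_X X1_neq0 i_pull).
  by rewrite -size_poly_gt0 size_p.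
have -> : map_poly i p = map_poly f (minPoly 1 x).
  by rewrite ep -map_poly_comp; apply: eq_map_poly => c /=; rewrite fi.
by rewrite -[y ord0]gK horner_map /= (rootP (root_minPoly 1 x)) rmorph0.
Qed.

End Counting.

(** * Multiplicity and the theorem *)

Section Multiplicity.

Variables (k : fieldType) (n d : nat) (X : hypersurface k n d).
Local Notation f := (poly_X0 (defpoly X)).

Lemma dehom_X0 (F : {mpoly k[n.+2]}) :
  F \mPo [tuple of 1 :: [tuple 'X_i | i < n.+1]] = (poly_X0 F).[1].
Proof.
pose R0 := {mpoly k[n.+1]}.
pose u : {rmorphism {mpoly k[n.+2]} -> R0} :=
  comp_mpoly [tuple of 1 :: [tuple 'X_i | i < n.+1]].
pose v : {rmorphism {mpoly k[n.+2]} -> R0} := horner_eval 1 \o @poly_X0 k n.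
apply: (mpoly_morph_ext (f := u) (g := v)) => [c|i]; rewrite /u /v /=.
  by rewrite comp_mpolyC poly_X0C /horner_eval hornerC.
rewrite comp_mpolyXU -tnth_nth /horner_eval; case: (unliftP ord0 i) => [l|] ->.
  by rewrite poly_X0_lift hornerC tnthS tnth_mktuple.
by rewrite poly_X0_X0 hornerX tnth0.
Qed.

Lemma poly_X0_supp l t : (f`_l)@_t != 0 -> (l + mdeg t)%N = d.
Proof.
have [hl l0] := poly_X0_coef_homog l (defpoly_homog X); move=> nz.
have le_ld : (l <= d)%N.
  by rewrite leqNgt; apply: contra nz => /l0 ->; rewrite mcoeff0.
by have := dhomog_mf hl; move/(_ t) => /= ->; rewrite ?subnKC // mcoeff_msupp.
Qed.

(** Setting X_0 = 1 merges no two monomials of a form, since the degree in the other variables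
    determines the exponent of X_0. *)
Lemma mcoeff_dehom_X0 t l : (l + mdeg t)%N = d -> (f.[1])@_t = (f`_l)@_t.
Proof.
move=> el; rewrite horner_coef raddf_sum /=.
under eq_bigr do rewrite expr1n mulr1.
have z (a : nat) : a != l -> (f`_a)@_t = 0.
  move=> ne; apply/eqP; apply: contraNT ne => /poly_X0_supp ea.
  by rewrite -(eqn_add2r (mdeg t)) ea el.
have [lt_l|le_l] := ltnP l (size f).
  by rewrite (bigD1 (Ordinal lt_l)) //= big1 ?addr0 // => a ne; apply: z.
rewrite [f`_l]nth_default // mcoeff0 big1 // => a _; apply: z.
by rewrite neq_ltn (leq_trans (ltn_ord a)).
Qed.

(** The highest power of X_0 goes with the least degree in the other variables, which is the
    multiplicity. *)
Lemma size_poly_X0 m : multiplicity_at_P X m -> (m <= d)%N ->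
  size f = (d - m).+1.
Proof.
move=> [ge_m [t0 t0s et0]] le_md; rewrite dehom_X0 in ge_m t0s.
apply/eqP; rewrite eqn_leq; apply/andP; split.
  apply/leq_sizeP => l lt_l; apply/mpolyP => t; rewrite mcoeff0.
  apply/eqP/negPn/negP => nz; have el := poly_X0_supp nz.
  have := ge_m t; rewrite mcoeff_msupp (mcoeff_dehom_X0 el) => /(_ nz).
  by move=> le_mt; move: lt_l; rewrite -el -addnBA // ltnNge leq_addr.
rewrite ltnNge; apply: contraTN t0s => sz; rewrite mcoeff_msupp.
rewrite (@mcoeff_dehom_X0 _ (d - m)%N) ?et0 ?subnK //.
by rewrite nth_default // mcoeff0 eqxx.
Qed.

End Multiplicity.

(** Induction on [s] with a^p - 1 = (a - 1)^p, the additivity of Frobenius. *)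
Lemma pchar_expX_eq1 (k : fieldType) p s (a : k) : p \in [pchar k] ->
  a ^+ (p ^ s) = 1 -> a = 1.
Proof.
move=> pk; elim: s => [|s IH]; first by rewrite expn0 expr1.
rewrite expnSr exprM => e; apply: IH.
have := pFrobenius_autB_comm pk (mulrC (a ^+ (p ^ s)) 1).
rewrite !pFrobenius_autE e expr1n subrr => /eqP; rewrite expf_eq0.
by case/andP => _; rewrite subr_eq0 => /eqP.
Qed.

Theorem theorem3p7 (k : closedFieldType) (p n d m u l : nat)
    (X : hypersurface k n d)
    (gT : finGroupType) (G Gp : {group gT}) (rG : mx_representation k G n.+2)
    (h : gT) (e_l : k) :
  p \in [pchar k] ->
  (1 <= n)%N -> (3 <= d)%N ->
  multiplicity_at_P X m -> (m < d)%N ->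
  wild_galois_point X p m ->
  extendable X ->
  (d - m = p ^ u * l)%N -> gcdn p l = 1%N ->
  mx_faithful rG ->
  (forall g, g \in G -> in_UT (rG g)) ->
  [/\ forall g, g \in G -> in_galois_PGL X (rG g),
      {in G &, forall g1 g2, same_PGL (rG g1) (rG g2) -> g1 = g2} &
      forall A, in_galois_PGL X A -> exists2 g, g \in G & same_PGL A (rG g)] ->
  (p.-Sylow(G) Gp)%g ->
  l.-primitive_root e_l ->
  h \in G ->
  rG h = block_mx (e_l%:M : 'M_1) 0 0 (1%:M : 'M_n.+1) ->
  G :=: <<h |: Gp>>%g ->
  exists A B : {mpoly k[n.+1]},
    [/\ A \is m.-homog, B \is d.-homog &
        defpoly X = piP_pull A * \prod_(g in G) pullback (rG g) 'X_ord0
                    + piP_pull B].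
Proof.
move=> pk _ _ multX lt_md [[i i_pull gal] _] ext edm _ _ UT [G_gal G_inj G_surj].
move=> sylGp prim hG rGh defG; set f := poly_X0 (defpoly X).
have size_f : size f = (d - m).+1 by apply: size_poly_X0; rewrite // ltnW.
have size_X : (1 < size f)%N by rewrite size_f ltnS subn_gt0.
pose chi g := rG g ord0 ord0.
have chiM : {in G &, {morph chi : a b / (a * b)%g >-> a * b}}.
  by move=> a b aG bG; rewrite /chi repr_mxM // in_UT_cornerM //; apply: UT.
have chi1 : chi 1%g = 1 by rewrite /chi repr_mx1 mxE eqxx.
have chil : {in G, forall g, chi g ^+ l = 1}.
  (* These elements form a subgroup, so it is enough to find the generators of [G] in it. *)
  pose H := [set g in G | chi g ^+ l == 1].
  have gH : group_set H.
    apply/group_setP; split=> [|a b]; first by rewrite inE group1 chi1 expr1n eqxx.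
    rewrite !inE => /andP[aG /eqP ea] /andP[bG /eqP eb].
    by rewrite groupM // chiM // exprMn ea eb mulr1 eqxx.
  suff /subsetP GH : G \subset Group gH by move=> g /GH; rewrite inE => /andP[_ /eqP].
  rewrite {1}defG gen_subG subUset sub1set /= inE hG.
  rewrite /chi rGh (block_mx_fstE e_l 0).1 (prim_expr_order prim) eqxx /=.
  apply/subsetP => g gGp; have gG : g \in G := subsetP (pHall_sub sylGp) g gGp.
  (* The order of [Gp] is a power of p, so the value of [chi] at [g] is a root of unity of p-power
     order, hence 1. *)
  rewrite inE gG /=; suff -> : chi g = 1 by rewrite expr1n.
  have chiX a : chi (g ^+ a)%g = chi g ^+ a.
    elim: a => [|a IH]; first by rewrite expg0 chi1.
    by rewrite expgS exprS chiM ?groupX // IH.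
  have [[s es] pr_p] : (exists s, #|Gp| = p ^ s)%N /\ prime p.
    by split; [have [s] := p_natP (pHall_pgroup sylGp); exists s|exact: pcharf_prime pk].
  by apply: (pchar_expX_eq1 (s := s) pk); rewrite -es -chiX expg_cardG.
have f_inv : {in G, forall g, f \Po affine (rG g) = f}.
  move=> g gG; have [_ [c [_ ec]] _] := G_gal g gG.
  (* Preserving X gives invariance up to a scalar [c]. The degree d - m of [f] is a multiple of [l],
     so the corner to that power is 1 and [c] drops out. *)
  apply: (comp_affine_scale (c := c) (UT g gG)).
  - by rewrite -size_poly_gt0 size_f.
  - by rewrite size_f /= edm mulnC exprM -/(chi g) chil // expr1n.
  - by rewrite /f -(poly_X0_pullback _ (UT g gG)) ec -mul_mpolyC rmorphM /= poly_X0C.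
have r_inj : {in G &, injective (fun g => affine (rG g))}.
  move=> a b aG bG /(affine_inj (UT a aG) (UT b bG)) e.
  by apply: G_inj => //; exists 1; rewrite oner_neq0 scale1r.
have size_G : (size f <= #|G|.+1)%N.
  have ker_q := @coord_proj_eq0 k n d X; have X1 := X1_neq0 size_X.
  have := @conjugates_bound k n d X _ (@coord_proj k n d X) ker_q size_X X1 i i_pull.
  (* The candidates a X_0/X_1 + b for the conjugates, one for each element of [G]. *)
  pose orb := [seq dehom (@coord_proj k n d X) (lift ord0 ord0)
                 (tnth (linear_map (rG g)) ord0) | g <- enum G].
  move/(_ orb gal); rewrite size_map -cardE; apply => s t fs ft st ts.
  have [A [galA [e [c indA]]]] := extendable_induced ker_q X1 ext fs ft st ts.
  have [g gG eA] := G_surj A galA.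
  apply/mapP; exists g; first by rewrite mem_enum.
  exact: (in_UT_induced X1 indA eA (UT g gG)).
have fE := affine_invariant_factor (cardG_gt0 G) r_inj size_G f_inv.
(* The sign comes from evaluating the product of the Y - (a T + b) at Y = 0. *)
exists (- (-1) ^+ #|G| * f`_#|G|), f`_0.
have [hG0 _] := poly_X0_coef_homog 0 (defpoly_homog X); split.
- have [hN _] := poly_X0_coef_homog #|G| (defpoly_homog X).
  (* Only d - m <= |G| is at hand: under equality this coefficient has degree d - (d - m) = m, and
     otherwise it is zero, which is a form of every degree. *)
  have hf : f`_#|G| \is m.-homog.
    move: size_G; rewrite size_f ltnS leq_eqVlt => /predU1P[eN|ltN].
      by move: hN; rewrite -/f -eN subKn // ltnW.
    by rewrite nth_default ?size_f // dhomog0.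
  have -> : - (-1) ^+ #|G| * f`_#|G| = (- (-1) ^+ #|G|) *: f`_#|G|.
    by rewrite -mul_mpolyC rmorphN rmorphXn rmorphN /= mpolyC1.
  exact: dhomogZ.
- by rewrite subn0 in hG0.
apply: (@poly_X0_inj k n); rewrite rmorphD rmorphM /= !poly_X0_pull rmorph_prod /=.
rewrite -/f {1}fE; congr (_ * _ + _); apply: eq_bigr => g gG.
exact: (esym (poly_X0_pullback_X0 (rG g))).
Qed.
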